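(* Let $n\ge1$ and, for each $N\ge n$, let $T_N$ be a finite rooted tree of height $n$ all of whose branches extend up to the $n$-th level, with associated quantities $B_{iN}$, $B_N$, $s_{iN}^2$, i.i.d. symmetric random variables $\xi(\sigma_1\cdots\sigma_i)$ and random probability $\mu_N$ on $\mathbb{R}^n$ as described in the context. Let $\triangle=\triangle_1\times\cdots\times\triangle_n\subset\mathbb{R}^n$ with each $\triangle_i\subset\mathbb{R}$ Borel, and put $q_{iN}=P(\xi\in\triangle_i)$ for $1\le i\le n$, where $\xi$ has the common distribution of the $\xi(\sigma_1\cdots\sigma_i)$ for the given $N$. (a) If $\sum_{N\ge n}B_{iN}\,q_{1N}\cdots q_{iN}<\infty$ for some $i$, $1\le i\le n$, then almost surely eventually (i.e. for all sufficiently large $N$) $\mu_N(\triangle)=0$. (b) If for all $i=1,\dots,n$, $\sum_{N\ge n}\dfrac{s_{iN}^2}{B_N^2\,q_{1N}\cdots q_{iN}}<\infty$, then for any $\epsilon>0$, almost surely eventually $$(1-\epsilon)\,\mathbf{E}\mu_N(\triangle)\le\mu_N(\triangle)\le(1+\epsilon)\,\mathbf{E}\mu_N(\triangle).$$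
   Context: Nodes of $T_N$ at the first level are denoted $\sigma_1$; the nodes at level $i$ below a node $\sigma_1\cdots\sigma_{i-1}$ of level $i-1$ are denoted $\sigma_1\cdots\sigma_{i-1}\sigma_i$. $\Sigma_N$ is the set of all branches $\sigma=\sigma_1\cdots\sigma_n$. $B_{iN}$ is the number of nodes at level $i$, and $B_N=B_{nN}$ is the number of branches (leaves). For a node $\sigma_1\cdots\sigma_i$ of level $i$, $e(\sigma_1\cdots\sigma_i)$ is the number of level-$n$ nodes below it (the number of branches extending it), and $s_{iN}^2=\sum_{\sigma_1\cdots\sigma_i}e^2(\sigma_1\cdots\sigma_i)$, the sum being over all level-$i$ nodes. For fixed $N$, to every node $\sigma_1\cdots\sigma_i$, $1\le i\le n$, is attached a symmetric real random variable $\xi(\sigma_1\cdots\sigma_i)$, all these being i.i.d. (their common law may depend on $N$); all random variables, for all $N$, live on one probability space. For $\sigma\in\Sigma_N$ put $\xi_\sigma=(\xi(\sigma_1),\xi(\sigma_1\sigma_2),\dots,\xi(\sigma_1\cdots\sigma_n))\in\mathbb{R}^n$, and for Borel $A\subset\mathbb{R}^n$ let $\mu_N(A)=\frac1{B_N}\#\{\sigma\in\Sigma_N:\xi_\sigma\in A\}$. A term with zero denominator is understood as $+\infty$. *)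

(* Defs.v *)
From mathcomp Require Import all_boot all_order all_algebra.
From mathcomp Require Import all_classical all_reals all_analysis.

Set Implicit Arguments.
Unset Strict Implicit.
Unset Printing Implicit Defensive.

Import Order.TTheory GRing.Theory Num.Theory.
Import numFieldNormedType.Exports.

Local Open Scope classical_set_scope.
Local Open Scope ring_scope.

(* A finite rooted tree of height [n] all of whose branches extend up to level
   [n], given by its parent map. The axioms force [parent root = root] (a dummy
   value), make [level v] the distance from [v] to the root, and hence make
   every vertex a descendant of the root. The children of [v] are the
   [w != root] with [parent w = v]. *)
Record rtree (n : nat) := RTree {
  vertex :> finType;
  root : vertex;
  parent : vertex -> vertex;
  level : vertex -> nat;
  level_eq0 : forall v, (level v == 0)%N = (v == root);
  level_parent : forall v, level (parent v) = (level v).-1;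
  level_max : forall v, (level v <= n)%N;
  branch_extends : forall v, (level v < n)%N ->
    exists2 w, w != root & parent w = v
}.

Arguments root {n r}.
Arguments parent {n r}.
Arguments level {n r}.

Section Tree.
Variables (n : nat) (t : rtree n).
Implicit Types (v w s : t) (i : nat).

(* The ancestor of [v] at level [i], for [i <= level v]. *)
Definition ancestor i v : t := iter (level v - i) parent v.

Definition nodes_at i : {set t} := [set v | level v == i].

(* A branch [s_1 ... s_n] is identified with its level-[n] end node; its
   initial segment [s_1 ... s_i] is then [ancestor i s]. *)
Definition branches : {set t} := nodes_at n.

Definition nb_branches_through v : nat :=
  #|[set s in branches | ancestor (level v) s == v]|.

Definition sq_branching i : nat :=
  (\sum_(v in nodes_at i) nb_branches_through v ^ 2)%N.

End Tree.

Section Random.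
Context d (T : measurableType d) (R : realType) (P : probability T R).

(* Mutual independence of the variables [X i], [i] in [D]. *)
Definition mutually_independent (I : finType) (D : {set I})
    (X : I -> {RV P >-> R}) : Prop :=
  forall J : {set I}, J \subset D ->
  forall A : I -> set R, (forall i, measurable (A i)) ->
    P (\bigcap_(i in [set` J]) (X i @^-1` A i)) =
    (\prod_(i in J) P (X i @^-1` A i))%E.

Definition symmetric_law (m : probability R R) : Prop :=
  forall A : set R, measurable A -> m ((fun x : R => - x) @^-1` A) = m A.

(* The variables attached to the nodes of levels [1..n] (that is, to the
   vertices other than the root) are i.i.d. with common law [m]; [xi root] is
   an unconstrained dummy. *)
Definition iid_on_nodes n (t : rtree n) (xi : t -> {RV P >-> R})
    (m : probability R R) : Prop :=
  mutually_independent [set v : t | v != root] xi /\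
  forall v : t, v != root ->
    forall A : set R, measurable A -> distribution P (xi v) A = m A.

Definition branch_vector n (t : rtree n) (xi : t -> {RV P >-> R}) (s : t)
    (w : T) : n.-tuple R :=
  [tuple xi (ancestor i.+1 s) w | i < n].

Definition empirical n (t : rtree n) (xi : t -> {RV P >-> R})
    (A : set (n.-tuple R)) (w : T) : R :=
  #|[set s in branches t | `[< A (branch_vector xi s w) >]]|%:R
  / #|branches t|%:R.

End Random.

Definition box (R : realType) n (D : 'I_n -> set R) : set (n.-tuple R) :=
  [set x | forall i, D i (tnth x i)].

(* With 0-based indices: [m (D 0) * ... * m (D i)]. *)
Definition prod_upto (R : realType) n (m : probability R R)
    (D : 'I_n -> set R) (i : 'I_n) : R :=
  \prod_(j < n | (j <= i)%N) fine (m (D j)).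

(* Division in which a zero denominator gives [+oo]. *)
Definition div_oo (R : realType) (a b : R) : \bar R :=
  if b == 0 then +oo%E else (a / b)%:E.

(* Main.v *)
Require Import Defs.
From mathcomp Require Import all_boot all_order all_algebra.
From mathcomp Require Import all_classical all_reals all_analysis.
From mathcomp Require Import measurable_realfun ring lra zify.
Import Order.TTheory GRing.Theory Num.Theory.
Import numFieldNormedType.Exports.
Local Open Scope classical_set_scope.
Local Open Scope ring_scope.

Set Implicit Arguments.
Unset Strict Implicit.
Unset Printing Implicit Defensive.

(** Call a node successful when the labels along the path leading to it lie in the
    successive sides [D_1, D_2, ...] of the box. A node of level [i] is successful
    with probability [Q_i = q_1 ... q_i], and the empirical frequency of the box is
    the proportion of successful branches. Both parts follow from the first
    Borel-Cantelli lemma ([borel_cantelli_near]), part (a) by a first-moment and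
    part (b) by a second-moment estimate for a fixed tree.

    (a) If the frequency is not zero, some branch is successful, hence so is its
    node of level [i] ([empirical_neq0_path_event]). The probability that some node
    of level [i] is successful is at most [B_i Q_i] ([prob_some_path_event]).

    (b) The frequency has mean [Q_n] ([expectation_empirical]). Two branches that
    share exactly their first [i > 0] nodes are both successful with probability
    [Q_n^2 / Q_i], and branches that share no node succeed independently; so the
    covariance is at most the sum of [Q_n^2 / Q_i] over all levels [i > 0] at which
    the branches agree ([cov_path_event]). As [s_i^2] counts the pairs of branches
    agreeing up to level [i] ([count_pairs_same_ancestor]), the variance of the
    frequency is at most [Q_n^2] times the sum over [i] of [s_i^2 / (B^2 Q_i)].
    By Chebyshev's inequality, a relative deviation [eps] from the mean then has
    probability at most [eps^-2] times that last sum ([empirical_concentration]),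
    which is summable in [N] by hypothesis. *)

(** * Paths in a tree *)

Section Trees.
Variables (n : nat) (t : rtree n).
Implicit Types (u v s : t) (i j : nat).

Lemma level_iter_parent k v : level (iter k parent v) = (level v - k)%N.
Proof. by elim: k => [|k IHk] /=; rewrite ?subn0// level_parent IHk subnS. Qed.

Lemma level_ancestor i v : (i <= level v)%N -> level (ancestor i v) = i.
Proof. by move=> iv; rewrite level_iter_parent subKn. Qed.

Lemma ancestor_ancestor i j v : (i <= j)%N -> (j <= level v)%N ->
  ancestor i (ancestor j v) = ancestor i v.
Proof.
move=> ij jv; rewrite {1}/ancestor level_ancestor// /ancestor -iterD.
by congr (iter _ _ _); lia.
Qed.

(** The path below the root down to [v]: the root is left out because it carries
    no random label. *)
Definition path_to v : {set t} := [set ancestor j.+1 v | j : 'I_(level v)].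

Lemma path_toP u v : reflect
  [/\ (0 < level u)%N, (level u <= level v)%N & ancestor (level u) v = u]
  (u \in path_to v).
Proof.
apply: (iffP imsetP) => [[j _ ->]|[u0 uv e]].
  by rewrite level_ancestor.
have lt : ((level u).-1 < level v)%N by rewrite prednK.
by exists (Ordinal lt); rewrite //= prednK.
Qed.

Lemma path_to_neq_root u v : u \in path_to v -> u != Defs.root.
Proof. by case/path_toP => u0 _ _; rewrite -level_eq0 -lt0n. Qed.

(** A path meets each level [1 .. level v] exactly once, so an iterated operation
    over its nodes that depends on levels only is one over the levels, here
    counted from [0]. *)
Lemma big_path_to (M : Type) (idx : M) (op : Monoid.com_law idx) (f : nat -> M) v :
  \big[op/idx]_(u in path_to v) f (level u).-1 = \big[op/idx]_(j < level v) f j.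
Proof.
rewrite big_imset /=; last first.
  move=> j k _ _ /(congr1 level); rewrite !level_ancestor// => -[jk].
  exact: val_inj.
by apply: eq_big => // j _; rewrite level_ancestor.
Qed.

Lemma path_to_sub u v : u \in path_to v -> path_to u \subset path_to v.
Proof.
case/path_toP => u0 uv eu; apply/fintype.subsetP => w /path_toP[w0 wu ew].
apply/path_toP; split=> //; first exact: leq_trans uv.
by have := ancestor_ancestor wu uv; rewrite eu ew => <-.
Qed.

(** Two paths share an initial segment: a node on both carries all its ancestors
    along with it, so their common part is the path to its deepest node. *)
Lemma path_toI v v' :
  path_to v :&: path_to v' = finset.set0 \/
  exists2 u, u \in path_to v :&: path_to v' &
    path_to v :&: path_to v' = path_to u.
Proof.
have [->|[u0 u0P]] := set_0Vmem (path_to v :&: path_to v'); [by left|right].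
have [u uP umax] := @arg_maxnP _ u0 [in path_to v :&: path_to v'] level u0P.
have /setIP[uv uv'] := uP.
exists u => //; apply/eqP; rewrite finset.eqEsubset finset.subsetI !path_to_sub// !andbT.
apply/fintype.subsetP => w wP; have wu := umax w wP.
case/setIP: wP => /path_toP[w0 _ ew] _; case/path_toP: uv => _ uv eu.
by apply/path_toP; split=> //; have := ancestor_ancestor wu uv; rewrite eu ew.
Qed.

(** The combinatorial meaning of [s_i^2]: grouping the branches by their node
    [v] of level [i], each of the [e(v)] branches through [v] agrees up to level
    [i] with exactly [e(v)] branches. *)
Lemma count_pairs_same_ancestor i : (i <= n)%N ->
  (\sum_(s in branches t) \sum_(s' in branches t) (ancestor i s == ancestor i s')
   = sq_branching t i)%N.
Proof.
move=> i_n.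
have lev s : s \in branches t -> level (ancestor i s) = i.
  by rewrite inE => /eqP sn; rewrite level_ancestor ?sn.
rewrite (partition_big (ancestor i) [in nodes_at t i]) /=; last first.
  by move=> s sb; rewrite inE lev.
apply: eq_bigr => v; rewrite inE => /eqP vi.
have cnt : nb_branches_through v = (\sum_(s' in branches t) (v == ancestor i s'))%N.
  rewrite /nb_branches_through -sum1_card big_mkcond [RHS]big_mkcond /=.
  apply: eq_bigr => s _; rewrite inE vi eq_sym.
  by case: (s \in branches t); case: (v == _).
rewrite (eq_bigr (fun=> nb_branches_through v)); last first.
  by move=> s /andP[_ /eqP ->]; rewrite cnt.
rewrite sum_nat_const -mulnn; congr (_ * _)%N.
by rewrite /nb_branches_through cardsE vi.
Qed.

End Trees.

(** * First and second moments of counting variables *)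

Section Probability.
Context d (T : measurableType d) (R : realType) (P : probability T R).

(** The first Borel-Cantelli lemma with domination by a summable sequence.
    Replacing the events of index less than [n] by the empty set reduces to the
    limit superior of a sequence indexed from [0]. *)
Lemma borel_cantelli_near (n : nat) (A : nat -> set T) (u : nat -> \bar R) :
  (forall N, (n <= N)%N -> measurable (A N)) ->
  (forall N, (n <= N)%N -> (P (A N) <= u N)%E) ->
  (\sum_(n <= N <oo) u N < +oo)%E ->
  {ae P, forall w, \forall N \near \oo, ~ A N w}.
Proof.
move=> mA Au su; pose B N := if (n <= N)%N then A N else set0.
have mB N : measurable (B N).
  by rewrite /B; case: ifPn => // /mA.
have sB : (\sum_(0 <= N <oo) P (B N) < +oo)%E.
  apply: le_lt_trans su.
  rewrite [leRHS]eseries_cond eseries_mkcondr.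
  apply: lee_nneseries => // N _; rewrite /B; case: ifPn => [/Au//|_].
  by rewrite measure0.
exists (lim_sup_set B); split.
- by apply: bigcap_measurable => // k _; apply: bigcup_measurable.
- exact: lim_sup_set_cvg0.
- move=> w /= nw k _; apply: contrapT => nB; apply: nw.
  exists (maxn n k) => // N /=; rewrite geq_max => /andP[nN kN] AN.
  by apply: nB; exists N => //; rewrite /B nN.
Qed.

Lemma Lfun_indic (p : R) (A : set T) : measurable A -> 1 <= p ->
  (\1_A : T -> R) \in Lfun P p%:E.
Proof.
move=> mA p1; rewrite inE/=; apply/andP; split; rewrite inE//=.
rewrite /finite_norm unlock poweR_lty//.
rewrite (eq_integral (fun x => (\1_A x)%:E)) ?integral_indic// ?setIT.
  by rewrite ltey_eq fin_num_measure.
move=> x _ /=; rewrite indicE; case: (_ \in _).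
  by rewrite normr1 powR1.
by rewrite normr0 powR0// gt_eqF// (lt_le_trans ltr01).
Qed.

Lemma expectation_sum_indic (I : Type) (r : seq I) (F : I -> set T) :
  (forall i, measurable (F i)) ->
  ('E_P[(fun w => \sum_(i <- r) \1_(F i) w)%R] = \sum_(i <- r) P (F i))%E.
Proof.
move=> mF; rewrite unlock.
under eq_integral do rewrite -sumEFin.
rewrite ge0_integral_sum//.
- by apply: eq_bigr => i _; rewrite integral_indic// setIT.
- by move=> i; apply/measurable_EFinP.
Qed.

Lemma variance_sum_indic (I : Type) (r : seq I) (F : I -> set T) :
  (forall i, measurable (F i)) ->
  ('V_P[(fun w => \sum_(i <- r) \1_(F i) w)%R] =
   (\sum_(i <- r) \sum_(j <- r)
      (fine (P (F i `&` F j)) - fine (P (F i)) * fine (P (F j))))%:E)%E.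
Proof.
move=> mF; have mFF i j : measurable (F i `&` F j) by apply: measurableI.
have Pfin A : measurable A -> (fine (P A))%:E = P A.
  by move=> mA; rewrite fineK// fin_num_measure.
set X := (fun w => _).
have X2 : X \in Lfun P 2%:E.
  rewrite /X (_ : (fun w => _) = \sum_(i <- r) \1_(F i)); last first.
    by apply/funext => w; rewrite fct_sumE.
  by apply: rpred_sum => [|? i _]; [rewrite lee1n|apply: Lfun_indic; rewrite ?ler1n].
rewrite varianceE// expectation_sum_indic//.
rewrite (_ : X ^+ 2 = (fun w => \sum_(p <- [seq (i, j) | i <- r, j <- r])
   \1_(F p.1 `&` F p.2) w)); last first.
  apply/funext => w; rewrite big_allpairs /= -[LHS]/(X w ^+ 2) expr2.
  rewrite /X big_distrlr /=; apply: eq_bigr => i _; apply: eq_bigr => j _.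
  by rewrite indicI.
rewrite (@expectation_sum_indic _ _ (fun p => F p.1 `&` F p.2))// big_allpairs /=.
under eq_bigr => i _ do under eq_bigr => j _ do rewrite -Pfin//.
under eq_bigr => i _ do rewrite sumEFin.
rewrite sumEFin.
under [X in (_ - X ^+ 2)%E]eq_bigr => i _ do rewrite -Pfin//.
rewrite sumEFin -EFin_expe -EFinB expr2 big_distrlr /= -sumrB.
by under [in RHS]eq_bigr => i _ do rewrite sumrB.
Qed.

(** Chebyshev's inequality for the number of events [F i] that occur, whose
    variance is the sum of the pairwise covariances of the events. *)
Lemma chebyshev_sum_indic (I : Type) (r : seq I) (F : I -> set T) (c : R) :
  (forall i, measurable (F i)) -> 0 < c ->
  (P [set w | (c <= `|\sum_(i <- r) \1_(F i) w - \sum_(i <- r) fine (P (F i))|)%R] <=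
   (c ^- 2 * \sum_(i <- r) \sum_(j <- r)
      (fine (P (F i `&` F j)) - fine (P (F i)) * fine (P (F j))))%:E)%E.
Proof.
move=> mF c0.
have mX : measurable_fun setT (fun w => \sum_(i <- r) \1_(F i) w : R).
  by apply: measurable_sum => i; exact: measurable_indic.
pose X : {RV P >-> R} := mfun_Sub (mem_set mX).
have := chebyshev X c0.
rewrite (_ : (X : T -> R) = (fun w => \sum_(i <- r) \1_(F i) w : R))//.
rewrite variance_sum_indic// expectation_sum_indic// EFinM.
congr (_ <= _)%E; congr (P _); apply/seteqP.
have e : fine (\sum_(i <- r) P (F i))%E = \sum_(i <- r) fine (P (F i)).
  rewrite (eq_bigr (fun i => (fine (P (F i)))%:E)) ?sumEFin// => i _.
  by rewrite fineK// fin_num_measure.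
by rewrite e; split.
Qed.

End Probability.

(** * Successful paths and the empirical frequency of a box *)

Section Labels.
Context d (T : measurableType d) (R : realType) (P : probability T R).
Variables (n : nat) (t : rtree n) (xi : t -> {RV P >-> R}).
Variables (m : probability R R) (D : 'I_n -> set R).
Hypotheses (iid : iid_on_nodes xi m) (mD : forall i, measurable (D i)).

(** The [k]-th side of the box, continued by the whole line outside ['I_n], so
    that it can be indexed by the level of an arbitrary node. *)
Definition side (k : nat) : set R := oapp D setT (insub k).

Definition side_prob (k : nat) : R := fine (m (side k)).

Definition path_prob (k : nat) : R := \prod_(j < k) side_prob j.

(** The labels along the path to [v] fall into the successive sides of the box.
    A node of level [k] is matched with the side of index [k.-1]. *)
Definition path_event (v : t) : set T :=
  \bigcap_(u in [set` path_to v]) (xi u @^-1` side (level u).-1).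

Lemma measurable_side k : measurable (side k).
Proof. by rewrite /side; case: insubP => [i _ _|_] /=. Qed.

Lemma prod_uptoE (i : 'I_n) : prod_upto m D i = path_prob i.+1.
Proof.
rewrite /path_prob (big_ord_widen_cond n xpredT side_prob) //.
by apply: eq_bigr => j _; rewrite /side_prob /side valK.
Qed.

Lemma side_prob_ge0 k : 0 <= side_prob k.
Proof. by rewrite fine_ge0. Qed.

Lemma path_prob_ge0 k : 0 <= path_prob k.
Proof. by apply: prodr_ge0 => j _; exact: side_prob_ge0. Qed.

Lemma measurable_side_event (u : t) : measurable (xi u @^-1` side (level u).-1).
Proof.
by rewrite -[X in measurable X]setTI; apply: measurable_funP => //; exact: measurable_side.
Qed.

Lemma measurable_path_event v : measurable (path_event v).
Proof.
apply: fin_bigcap_measurable => // u _.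
exact: measurable_side_event.
Qed.

Lemma prob_sides (J : {set t}) : Defs.root \notin J ->
  P (\bigcap_(u in [set` J]) (xi u @^-1` side (level u).-1)) =
  (\prod_(u in J) side_prob (level u).-1)%:E.
Proof.
move=> rJ; have Jroot u : u \in J -> u != Defs.root.
  by apply: contraTneq => ->.
have [ind idd] := iid.
rewrite ind; last first.
- by move=> u; exact: measurable_side.
- by apply/fintype.subsetP => u /Jroot; rewrite inE.
rewrite -prodEFin; apply: eq_bigr => u /Jroot ur.
rewrite -[LHS]/(distribution P (xi u) _) idd//; last exact: measurable_side.
by rewrite fineK// fin_num_measure//; exact: measurable_side.
Qed.

Lemma root_notin_path (v : t) : Defs.root \notin path_to v.
Proof. by apply/negP => /path_to_neq_root; rewrite eqxx. Qed.

Lemma prob_path_event v : P (path_event v) = (path_prob (level v))%:E.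
Proof.
by rewrite prob_sides ?root_notin_path// (big_path_to _ side_prob).
Qed.

(** For two paths, the labels to be controlled are those on the union, and the
    product over the union times the product over the intersection is the product
    of the two products. Keeping the common part as a factor on the left avoids
    dividing by a probability that may vanish. *)
Lemma prob_path_eventI (s s' : t) :
  fine (P (path_event s `&` path_event s')) *
    \prod_(u in path_to s :&: path_to s') side_prob (level u).-1
  = path_prob (level s) * path_prob (level s').
Proof.
have -> : path_event s `&` path_event s' =
    \bigcap_(u in [set` path_to s :|: path_to s']) (xi u @^-1` side (level u).-1).
  rewrite /path_event -bigcap_setU; congr (\bigcap_(u in _) _).
  apply/seteqP; split=> u /=; rewrite inE => /orP //.
rewrite prob_sides /=; last first.
  by rewrite inE negb_or !root_notin_path.
rewrite /path_prob -!(big_path_to _ side_prob).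
rewrite [X in X * _ = _](big_setID (path_to s)) /= finset.setUK finset.setDUl.
rewrite finset.setDv finset.set0U.
rewrite [X in _ = _ * X](big_setID (path_to s)) /= finset.setIC.
by rewrite -mulrA (mulrC (\prod_(u in _ :\: _) _)).
Qed.

(** If the paths to [s] and [s'] share exactly their first [i > 0] nodes, the
    preceding identity gives the joint probability [q^2 / (q_1 ... q_i)], with
    [q = q_1 ... q_n]; if they share no node, the two events are independent. One
    term of the sum on the right already dominates; summing over all common levels
    only makes the bound easy to add up over pairs of branches. *)
Lemma cov_path_event (s s' : t) : s \in branches t -> s' \in branches t ->
  (forall i : 'I_n, 0 < path_prob i.+1) ->
  fine (P (path_event s `&` path_event s'))
    - fine (P (path_event s)) * fine (P (path_event s'))
  <= path_prob n ^+ 2 *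
     \sum_(i < n) (ancestor i.+1 s == ancestor i.+1 s')%:R / path_prob i.+1.
Proof.
rewrite !inE => /eqP sn /eqP s'n Q0.
have term0 (i : 'I_n) :
    0 <= (ancestor i.+1 s == ancestor i.+1 s')%:R / path_prob i.+1.
  by rewrite divr_ge0// path_prob_ge0.
have := prob_path_eventI s s'.
rewrite !prob_path_event sn s'n /= -expr2 => PI.
case: (path_toI s s') PI => [->|[u /setIP[us us'] ->]].
  rewrite big_set0 mulr1 => ->; rewrite subrr.
  by rewrite mulr_ge0 ?exprn_ge0 ?path_prob_ge0// sumr_ge0.
rewrite (big_path_to _ side_prob) -/(path_prob _) => PI.
case/path_toP: us => u0; rewrite sn => un eu.
case/path_toP: us' => _ _ eu'.
(* [u] is the deepest common node; its level, shifted by one, selects the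
   dominating term of the sum. *)
have lt : ((level u).-1 < n)%N by rewrite prednK.
have := Q0 (Ordinal lt); rewrite /= prednK// => Qu.
have -> : fine (P (path_event s `&` path_event s')) = path_prob n ^+ 2 / path_prob (level u).
  by apply/(canRL (mulfK _)) => //; rewrite gt_eqF.
apply: (@le_trans _ _ (path_prob n ^+ 2 / path_prob (level u))).
  by rewrite gerBl sqr_ge0.
rewrite ler_wpM2l ?sqr_ge0// (bigD1 (Ordinal lt))//= prednK// eu eu' eqxx mul1r.
by rewrite lerDl sumr_ge0.
Qed.

Lemma box_path_event (s : t) w : s \in branches t ->
  box D (branch_vector xi s w) <-> path_event s w.
Proof.
rewrite inE => /eqP sn; split=> [Dw u /= /path_toP[u0 us eu]|pw i].
  rewrite sn in us; have lt : ((level u).-1 < n)%N by rewrite prednK.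
  have := Dw (Ordinal lt); rewrite tnth_mktuple /= prednK// eu.
  by rewrite /side insubT.
rewrite tnth_mktuple.
have lvl : level (ancestor i.+1 s) = i.+1 by rewrite level_ancestor ?sn.
have := pw (ancestor i.+1 s); rewrite /= lvl /= /side valK /=; apply.
by apply/path_toP; rewrite lvl sn.
Qed.

Lemma empiricalE w : empirical xi (box D) w =
  (\sum_(s <- enum (branches t)) \1_(path_event s) w) / #|branches t|%:R.
Proof.
rewrite /empirical; congr (_ / _); rewrite big_enum /= -sum1_card natr_sum.
rewrite big_mkcond [RHS]big_mkcond /=; apply: eq_bigr => s _.
rewrite inE; case: (boolP (s \in branches t)) => //= sb.
rewrite indicE (_ : `[< box D (branch_vector xi s w) >] = (w \in path_event s)); first by case: (_ \in _).
by apply/asboolP/idP; rewrite inE => /box_path_event -/(_ sb).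
Qed.

Lemma path_event_ancestor i (s : t) : (0 < i <= level s)%N ->
  path_event s `<=` path_event (ancestor i s).
Proof.
move=> /andP[i0 i_s] w ws u /= ui; apply: ws => /=.
move: u ui; apply/fintype.subsetP/path_to_sub/path_toP.
by rewrite level_ancestor.
Qed.

(** Union bound over the nodes of level [i], whose paths all have the same
    probability. *)
Lemma prob_some_path_event i :
  (P (\bigcup_(v in [set` nodes_at t i]) path_event v)
   <= (#|nodes_at t i|%:R * path_prob i)%:E)%E.
Proof.
apply: (@le_trans _ _ (\sum_(v \in [set` nodes_at t i]) P (path_event v))%E).
  apply: content_sub_fsum => //.
  - by move=> v _; exact: measurable_path_event.
  - by apply: fin_bigcup_measurable => // v _; exact: measurable_path_event.
have -> : [set` nodes_at t i] = [set` enum (nodes_at t i)].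
  by apply/seteqP; split=> v /=; rewrite mem_enum.
rewrite -fsbig_seq ?enum_uniq// big_enum /=.
rewrite (eq_bigr (fun=> (path_prob i)%:E)); last first.
  by move=> v; rewrite inE => /eqP vi; rewrite prob_path_event vi.
by rewrite sumEFin sumr_const mulr_natl.
Qed.

(** A branch whose labels lie in the box makes every initial segment of it
    successful, so a nonzero frequency is visible at each level. *)
Lemma empirical_neq0_path_event (i : 'I_n) w : empirical xi (box D) w != 0 ->
  (\bigcup_(v in [set` nodes_at t i.+1]) path_event v) w.
Proof.
rewrite empiricalE mulf_eq0 negb_or big_enum /= => /andP[+ _].
have [[s sb ws _]|no] :=
    pselect (exists2 s : t, s \in branches t & path_event s w); last first.
  rewrite big1 ?eqxx// => s sb; rewrite indicE memNset// => ws.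
  by apply: no; exists s.
move: (sb); rewrite inE => /eqP sn.
exists (ancestor i.+1 s); first by rewrite /= inE level_ancestor ?sn.
by move: ws; apply: path_event_ancestor; rewrite sn ltn_ord.
Qed.

Lemma sum_prob_branches :
  \sum_(s <- enum (branches t)) fine (P (path_event s)) = #|branches t|%:R * path_prob n.
Proof.
rewrite big_enum /= (eq_bigr (fun=> path_prob n)) ?sumr_const ?mulr_natl//.
by move=> s; rewrite inE => /eqP sn; rewrite prob_path_event sn.
Qed.

Lemma expectation_empirical : (0 < #|branches t|)%N ->
  ('E_P[empirical xi (box D)] = (path_prob n)%:E)%E.
Proof.
move=> B0; have Bn0 : #|branches t|%:R != 0 :> R by rewrite pnatr_eq0 -lt0n.
have mF s : measurable (path_event s) by exact: measurable_path_event.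
rewrite (_ : empirical xi (box D) = #|branches t|%:R^-1 \o*
   (fun w => \sum_(s <- enum (branches t)) \1_(path_event s) w)); last first.
  by apply/funext => w; rewrite empiricalE.
rewrite expectationZl; last first.
  rewrite (_ : (fun w => _) = \sum_(s <- enum (branches t)) \1_(path_event s)).
    by apply: rpred_sum => s _; apply: Lfun_indic.
  by apply/funext => w; rewrite fct_sumE.
rewrite expectation_sum_indic// big_enum /= (eq_bigr (fun=> (path_prob n)%:E)).
  by rewrite sumEFin sumr_const -EFinM -(mulr_natl (path_prob n)) mulKf.
by move=> s; rewrite inE => /eqP sn; rewrite prob_path_event sn.
Qed.

(** The second-moment bound. The covariances of the branch events add up, over
    all pairs of branches, to at most [q^2] times the sum of the
    [s_i^2 / (q_1 ... q_i)], because the pairs that agree up to level [i] number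
    [s_i^2]; dividing by the squared threshold [(eps * q * B)^2] leaves no [q]. *)
Lemma prob_empirical_deviation (eps : R) : 0 < eps ->
  (0 < #|branches t|)%N -> (forall i : 'I_n, 0 < path_prob i.+1) -> 0 < path_prob n ->
  (P [set w | (eps * path_prob n <= `|empirical xi (box D) w - path_prob n|)%R]
   <= (eps ^- 2 * \sum_(i < n) (sq_branching t i.+1)%:R
         / (#|branches t|%:R ^+ 2 * path_prob i.+1))%:E)%E.
Proof.
move=> eps0 B0 Q0 Qn0; set B := #|branches t|%:R : R.
have Bp : 0 < B by rewrite ltr0n.
have mF s : measurable (path_event s) by exact: measurable_path_event.
have c0 : 0 < eps * path_prob n * B by rewrite !mulr_gt0.
have := chebyshev_sum_indic P (enum (branches t)) mF c0.
rewrite sum_prob_branches -/B => ch.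
have dev w : `|\sum_(s <- enum (branches t)) \1_(path_event s) w - B * path_prob n|
    = `|empirical xi (box D) w - path_prob n| * B.
  by rewrite -{2}(gtr0_norm Bp) -normrM mulrBl empiricalE divfK ?gt_eqF// (mulrC B).
under eq_set => w do rewrite -(ler_pM2r Bp) -dev.
apply: (le_trans ch); rewrite lee_fin.
pose G s s' := path_prob n ^+ 2 *
     \sum_(i < n) (ancestor i.+1 s == ancestor i.+1 s' :> t)%:R / path_prob i.+1.
apply: (@le_trans _ _ ((eps * path_prob n * B) ^- 2 *
    \sum_(s in branches t) \sum_(s' in branches t) G s s')).
  rewrite ler_wpM2l ?invr_ge0 ?sqr_ge0// big_enum /=.
  apply: ler_sum => s sb; rewrite big_enum /=.
  by apply: ler_sum => s' s'b; exact: cov_path_event.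
have -> : \sum_(s in branches t) \sum_(s' in branches t) G s s' =
  path_prob n ^+ 2 * \sum_(i < n) (sq_branching t i.+1)%:R / path_prob i.+1.
  under eq_bigr => s _ do rewrite -mulr_sumr exchange_big /=.
  rewrite -mulr_sumr exchange_big /=; congr (_ * _); apply: eq_bigr => i _.
  rewrite -count_pairs_same_ancestor// natr_sum mulr_suml.
  by apply: eq_bigr => s _; rewrite natr_sum mulr_suml.
rewrite mulrA !mulr_sumr le_eqVlt; apply/orP; left; apply/eqP.
apply: eq_bigr => i _; field.
by rewrite !gt_eqF.
Qed.

Lemma measurable_empirical : measurable_fun setT (empirical xi (box D)).
Proof.
rewrite (funext empiricalE).
apply: measurable_funM => //; apply: measurable_sum => s.
by apply: measurable_indic; exact: measurable_path_event.
Qed.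

(** The previous bound without positivity assumptions: as soon as a denominator
    vanishes the right-hand side is infinite, and the whole space may be taken as
    exceptional set. This lets the summability hypothesis be used as it is, with
    no separate argument that its denominators are nonzero. *)
Lemma empirical_concentration (eps : R) : (0 < n)%N -> 0 < eps ->
  exists A : set T, [/\ measurable A,
    (P A <= (eps ^- 2)%:E * \sum_(i < n) div_oo (sq_branching t i.+1)%:R
              (#|branches t|%:R ^+ 2 * prod_upto m D i))%E &
    forall w, ~ A w ->
      ((1 - eps)%:E * 'E_P[empirical xi (box D)]
         <= (empirical xi (box D) w)%:E
         <= (1 + eps)%:E * 'E_P[empirical xi (box D)])%E].
Proof.
move=> n0 eps0; pose den (i : 'I_n) : R := #|branches t|%:R ^+ 2 * prod_upto m D i.
have eps2 : 0 < eps ^- 2 by rewrite invr_gt0 exprn_gt0.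
have [[i den0]|den_neq0] := pselect (exists i, den i = 0).
  exists setT; split => //; last by move=> w /(_ I).
  rewrite (_ : \sum_(i < n) _ = +oo)%E ?gt0_muley ?lte_fin ?leey//.
  apply/esum_eqyP; last first.
    by exists i; split=> //; rewrite /div_oo -/(den i) den0 eqxx.
  move=> j _; rewrite /div_oo; case: ifP => //.
have B0 : (0 < #|branches t|)%N.
  rewrite lt0n; apply/eqP => B0; apply: den_neq0; exists (Ordinal n0).
  by rewrite /den B0 expr0n mul0r.
have Q0 (i : 'I_n) : 0 < path_prob i.+1.
  rewrite lt_neqAle path_prob_ge0 andbT eq_sym; apply/eqP => Q0.
  by apply: den_neq0; exists i; rewrite /den prod_uptoE Q0 mulr0.
have Qn0 : 0 < path_prob n.
  have lt : (n.-1 < n)%N by rewrite prednK.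
  by have := Q0 (Ordinal lt); rewrite /= prednK.
exists [set w | eps * path_prob n <= `|empirical xi (box D) w - path_prob n|]; split.
- have mdev : measurable_fun setT
      (fun w => `|empirical xi (box D) w - path_prob n|).
    apply: measurableT_comp => //; apply: measurable_funB => //.
    exact: measurable_empirical.
  rewrite (_ : [set w | _] = setT `&`
    (fun w => `|empirical xi (box D) w - path_prob n|) @^-1` `[eps * path_prob n, +oo[).
    exact: mdev.
  by rewrite setTI; apply/seteqP; split=> w /=; rewrite in_itv /= andbT.
- rewrite (le_trans (prob_empirical_deviation eps0 B0 Q0 Qn0))// EFinM -sumEFin.
  rewrite lee_pmul2l//; apply: lee_sum => i _; rewrite /div_oo prod_uptoE.
  by case: ifP => //; rewrite leey.
- move=> w /negP; rewrite -ltNge ltr_norml => /andP[lo hi].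
  rewrite expectation_empirical// -!EFinM !lee_fin.
  by apply/andP; split; lra.
Qed.

End Labels.

Theorem theorem0p2p2 (d : measure_display) (Omega : measurableType d)
    (R : realType) (P : probability Omega R)
    (n : nat) (n_ge1 : (1 <= n)%N)
    (tree : nat -> rtree n)
    (law : nat -> probability R R)
    (xi : forall N : nat, tree N -> {RV P >-> R})
    (law_sym : forall N, (n <= N)%N -> symmetric_law (law N))
    (xi_iid : forall N, (n <= N)%N -> iid_on_nodes (xi N) (law N))
    (D : 'I_n -> set R) (mD : forall i, measurable (D i)) :
  ((exists i : 'I_n,
      (\sum_(n <= N <oo)
         (#|nodes_at (tree N) i.+1|%:R * prod_upto (law N) D i)%:E < +oo)%E) ->
    {ae P, forall w, \forall N \near \oo, empirical (xi N) (box D) w = 0})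
  /\
  ((forall i : 'I_n,
      (\sum_(n <= N <oo)
         div_oo (sq_branching (tree N) i.+1)%:R
                (#|branches (tree N)|%:R ^+ 2 * prod_upto (law N) D i)
       < +oo)%E) ->
    forall eps : R, 0 < eps ->
    {ae P, forall w, \forall N \near \oo,
      ((1 - eps)%:E * 'E_P[empirical (xi N) (box D)]
         <= (empirical (xi N) (box D) w)%:E
         <= (1 + eps)%:E * 'E_P[empirical (xi N) (box D)])%E}).
Proof.
split.
  move=> [i sumi].
  pose A N := \bigcup_(v in [set` nodes_at (tree N) i.+1]) path_event (xi N) D v.
  have mA N : (n <= N)%N -> measurable (A N).
    move=> _; apply: fin_bigcup_measurable => // v _.
    exact: measurable_path_event.
  have PA N : (n <= N)%N ->
      (P (A N) <= (#|nodes_at (tree N) i.+1|%:R * prod_upto (law N) D i)%:E)%E.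
    move=> nN; rewrite prod_uptoE.
    exact: (prob_some_path_event (xi_iid N nN) mD).
  apply: filterS (borel_cantelli_near mA PA sumi) => w.
  apply: filterS => N nA; apply/eqP; apply: contra_notT nA.
  exact: empirical_neq0_path_event.
move=> sums eps eps0.
pose good N w := ((1 - eps)%:E * 'E_P[empirical (xi N) (box D)]
  <= (empirical (xi N) (box D) w)%:E
  <= (1 + eps)%:E * 'E_P[empirical (xi N) (box D)])%E.
pose u N := ((eps ^- 2)%:E * \sum_(i < n) div_oo (sq_branching (tree N) i.+1)%:R
  (#|branches (tree N)|%:R ^+ 2 * prod_upto (law N) D i))%E.
have /choice[A HA] (N : nat) : exists A : set Omega, (n <= N)%N ->
    [/\ measurable A, (P A <= u N)%E & forall w, ~ A w -> good N w].
  have [nN|_] := leqP n N; last by exists set0.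
  have [A HA] := empirical_concentration (xi_iid N nN) mD n_ge1 eps0.
  by exists A.
have mA N : (n <= N)%N -> measurable (A N) by case/HA.
have PA N : (n <= N)%N -> (P (A N) <= u N)%E by case/HA.
have term_ge0 N (i : 'I_n) : (0 <= div_oo (sq_branching (tree N) i.+1)%:R
    (#|branches (tree N)|%:R ^+ 2 * prod_upto (law N) D i))%E.
  rewrite /div_oo prod_uptoE; case: ifP => // _.
  by rewrite lee_fin divr_ge0// mulr_ge0// ?sqr_ge0// path_prob_ge0.
have su : (\sum_(n <= N <oo) u N < +oo)%E.
  rewrite nneseriesZl; last by move=> N _; exact: sume_ge0.
  rewrite nneseries_sum; last by move=> i N _.
  rewrite lte_mul_pinfty ?lee_fin ?invr_ge0 ?sqr_ge0//.
  by apply: lte_sum_pinfty => i _; exact: sums.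
apply: filterS (borel_cantelli_near mA PA su) => w [K _ AK].
exists (maxn n K) => // N /=; rewrite geq_max => /andP[nN KN].
by have [_ _] := HA N nN; apply; exact: AK.
Qed.
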